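(* Let $r\geq 4$ and let $\mathcal{H}$ be an $r$-graph that is embeddable in a $2$-reducible $r$-tree. Let $\sigma=\sigma(\mathcal{H})$ and define $\beta:=1/((r-2)(\sigma+1)+1)$. Then, as $n\to\infty$ (with $\mathcal{H}$ fixed), $$(\sigma-1)\binom{n}{r-1}+O(n^{r-2})\leq \mathrm{ex}(n,\mathcal{H})\leq (\sigma-1)\binom{n}{r-1}+O(n^{r-1-\beta}).$$ Moreover, in the case $\sigma=1$ one has $\mathrm{ex}(n,\mathcal{H})=O(n^{r-2})$.
   Context: An $r$-graph is an $r$-uniform hypergraph. A (multi-)hypergraph with edges $E_1,\dots,E_m$ is a hypergraph tree if the edges can be ordered so that for every $i>1$ there is $\alpha(i)<i$ with $E_i\cap\bigcup_{j<i}E_j\subseteq E_{\alpha(i)}$; an $r$-uniform hypergraph tree is an $r$-tree. A hypergraph is $k$-reducible if each of its edges contains at least $k$ vertices of degree $1$. $\mathcal{H}$ is embeddable in $\mathcal{T}$ if there is an injective map $f:V(\mathcal{H})\to V(\mathcal{T})$ with $f(E)\in\mathcal{T}$ for all $E\in\mathcal{H}$. A cross-cut of $\mathcal{H}$ is a vertex set containing exactly one vertex of each edge; $\sigma(\mathcal{H})$ is the minimum size of a cross-cut (every $r$-graph embeddable in an $r$-tree has one). $\mathrm{ex}(n,\mathcal{H})$ is the maximum number of edges of an $r$-graph on $n$ vertices not containing $\mathcal{H}$ as a subgraph. *)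

(* Defs.v *)
From mathcomp Require Import all_boot.

Set Implicit Arguments.
Unset Strict Implicit.
Unset Printing Implicit Defensive.

(* A hypergraph on a finite vertex type V is its edge set, of type
   {set {set V}}; a multi-hypergraph is the sequence of its edges, repetitions
   counting as multiplicities and the order being irrelevant.
   Isolated vertices are allowed. *)

Definition is_uniform (V : finType) (r : nat) (H : {pred {set V}}) : bool :=
  [forall E in H, #|E| == r].

Definition hypertree (V : finType) (T : seq {set V}) : Prop :=
  exists2 s : seq {set V}, perm_eq s T &
    forall i : nat, 0 < i < size s ->
      exists2 a : nat, a < i &
        nth set0 s i :&: \bigcup_(j < i) nth set0 s j \subset nth set0 s a.

Definition rtree (V : finType) (r : nat) (T : seq {set V}) : Prop :=
  is_uniform r [in T] /\ hypertree T.

Definition degree (V : finType) (T : seq {set V}) (v : V) : nat :=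
  count (fun E : {set V} => v \in E) T.

Definition reducible (V : finType) (k : nat) (T : seq {set V}) : bool :=
  all (fun E : {set V} => k <= #|[set v in E | degree T v == 1]|) T.

(* With T an r-graph on 'I_n, this is also subgraph containment. *)
Definition embeddable (V W : finType) (H : {set {set V}})
    (T : {pred {set W}}) : bool :=
  [exists f : {ffun V -> W}, injectiveb f && [forall E in H, f @: E \in T]].

Definition crosscut (V : finType) (H : {set {set V}}) (S : {set V}) : bool :=
  [forall E in H, #|S :&: E| == 1].

(* The default #|V| bounds the size of every cross-cut, so this is the minimum
   size as soon as a cross-cut exists. *)
Definition crosscut_number (V : finType) (H : {set {set V}}) : nat :=
  \big[minn/#|V|]_(S : {set V} | crosscut H S) #|S|.

Definition turan_number (r n : nat) (V : finType) (H : {set {set V}}) : nat :=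
  \max_(G : {set {set 'I_n}} | is_uniform r G && ~~ embeddable H G) #|G|.

(* Main.v *)
(* Let F be an H-free r-graph on n vertices, let T be the tree on the vertex set
   W, put N = |W|, and call an (r-1)-set rich if more than N edges of F contain
   it. A k-graph with more than N times as many edges as its shadow contains
   every tree whose edges have at most k vertices. Hence
   - only O(n^(r-2)) edges contain two poor (r-1)-sets;
   - there are only O(n^(r-2)) rich sets, as T minus one leaf of each edge cannot
     embed into the (r-1)-graph of the rich sets.
   Every other edge E has a center x, such that all (r-1)-subsets of E through x
   are rich. So the links L_x = {E - x : x is a center of E} have shadows of total
   size O(n^(r-2)). If sigma = 1, then |L_x| <= N |shadow L_x| and we are done. In
   general, by Kruskal-Katona the vertices x with |shadow L_x| < t^(r-2)
   contribute O(t n^(r-2)) edges, and the others form a set A of size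
   O((n/t)^(r-2)). No sigma vertices of A have more than O(n^(r-2)) common members
   in their links, or else H embeds with a minimum crosscut sent to these
   vertices; so A contributes at most
   (sigma-1) C(n, r-1) + O(|A|^(sigma+1) n^(r-2)) edges. The choice
   t = n^(1-beta) balances the errors. For the lower bound, take all r-sets which
   meet a fixed (sigma-1)-set in exactly one vertex. *)
Require Import Defs.
From mathcomp Require Import all_boot zify.

Set Implicit Arguments.
Unset Strict Implicit.
Unset Printing Implicit Defensive.

(** * Shadows, codegrees and expandable sets *)

Definition shadow (X : finType) (L : {set {set X}}) : {set {set X}} :=
  [set D :\ x | D in L, x in D].

Definition codegree (X : finType) (L : {set {set X}}) (P : {set X}) : nat :=
  #|[set D in L | P \subset D]|.

(** Such a set can be completed to a member of [L] that stays clear of at most [N] forbidden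
    vertices, namely those an embedding has already used; for this purpose [N] will be [#|W|]. *)
Definition expandable (X : finType) (L : {set {set X}}) (N : nat)
    (Y : {set X}) : Prop :=
  forall Z : {set X}, #|Z| <= N ->
    exists2 D, D \in L & (Y \subset D) && (D :&: Z \subset Y).

Lemma uniform_card (X : finType) (k : nat) (L : {pred {set X}}) (D : {set X}) :
  is_uniform k L -> D \in L -> #|D| = k.
Proof. by move=> /forall_inP/(_ D) hL /hL/eqP. Qed.

Lemma uniformS (X : finType) (k : nat) (L L' : {set {set X}}) :
  L' \subset L -> is_uniform k L -> is_uniform k L'.
Proof.
by move=> /subsetP sL'L uL; apply/forall_inP => D /sL'L/(uniform_card uL)->.
Qed.

Lemma mem_shadow (X : finType) (L : {set {set X}}) (D : {set X}) (x : X) :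
  D \in L -> x \in D -> D :\ x \in shadow L.
Proof. by move=> DL xD; apply: imset2_f. Qed.

Lemma shadowS (X : finType) (L L' : {set {set X}}) :
  L' \subset L -> shadow L' \subset shadow L.
Proof.
move=> /subsetP sL'L; apply/subsetP => _ /imset2P[D x /sL'L DL xD ->].
exact: mem_shadow.
Qed.

Lemma shadow_uniform (X : finType) (k : nat) (L : {set {set X}}) :
  is_uniform k.+1 L -> is_uniform k (shadow L).
Proof.
move=> uL; apply/forall_inP => _ /imset2P[D x DL xD ->].
by have := uniform_card uL DL; rewrite (cardsD1 x) xD add1n => -[->].
Qed.

Lemma leq_bin_exp (n k : nat) : 'C(n, k) <= n ^ k.
Proof.
elim: k n => [|k IHk] [|n] //.
rewrite expnS -(leq_pmul2l (ltn0Sn k)) -mul_bin_diag.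
rewrite (leq_trans (leq_mul (leqnn _) (IHk n))) //= mulnCA leq_mul //.
apply: leq_trans (leq_pmull _ (ltn0Sn k)).
by case: k {IHk} => // k; rewrite leq_exp2r.
Qed.

Lemma uniform_leq_exp (X : finType) (k : nat) (L : {set {set X}}) :
  is_uniform k L -> #|L| <= #|X| ^ k.
Proof.
move=> uL; apply: leq_trans (leq_bin_exp _ _); rewrite -card_draws.
by apply/subset_leq_card/subsetP => D DL; rewrite inE (uniform_card uL DL).
Qed.

(** Distinct members above [P] add distinct single vertices to it, so at most [N] of them add a
    vertex of [Z]. *)
Lemma codegree_expandable (X : finType) (k N : nat) (L : {set {set X}})
    (P : {set X}) :
  is_uniform k.+1 L -> #|P| = k -> N < codegree L P -> expandable L N P.
Proof.
move=> uL cP ltN Z leZ; apply/exists_inP/contraT => /exists_inPn noD.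
suff /subset_leq_card : [set D in L | P \subset D] \subset [set z |: P | z in Z].
  by move/leq_trans/(_ (leq_imset_card _ _)); rewrite leqNgt (leq_ltn_trans leZ).
apply/subsetP => D; rewrite inE => /andP[DL PD].
have := noD D DL; rewrite PD => /subsetPn[z]; rewrite inE => /andP[zD zZ] zP.
apply/imsetP; exists z => //; apply/eqP; rewrite eq_sym eqEcard.
by rewrite cardsU1 zP cP (uniform_card uL DL) subUset sub1set zD PD /=.
Qed.

(* Deleting all members above one poor set of the shadow would preserve the
   hypothesis, so a minimal subfamily satisfying it works. *)
Lemma rich_subfamily (X : finType) (N : nat) (L : {set {set X}}) :
  N * #|shadow L| < #|L| ->
  exists L' : {set {set X}}, [/\ L' \subset L, L' != set0 &
    forall D x, D \in L' -> x \in D -> N < codegree L' (D :\ x)].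
Proof.
move=> ltL.
have [L' /minsetP[ltL' minL'] sL'L] :=
  minset_exists (P := fun K => N * #|shadow K| < #|K|) ltL.
exists L'; split=> // [|D x DL' xD].
  by rewrite -card_gt0 (leq_ltn_trans _ ltL').
set P := D :\ x; pose K := [set D in L' | ~~ (P \subset D)].
have KL' : K \subset L' by apply/subsetP => E; rewrite inE => /andP[].
have cL' : codegree L' P + #|K| = #|L'|.
  rewrite -(cardsID [set E : {set X} | P \subset E] L') /codegree; congr (_ + _).
    by apply: eq_card => E; rewrite !inE.
  by apply: eq_card => E; rewrite !inE andbC.
have ltK : #|shadow K| < #|shadow L'|.
  apply/proper_card/properP; split; first exact: shadowS.
  exists P; first exact: mem_shadow.
  apply/negP => /imset2P[E y]; rewrite inE => /andP[_ /negP nPE] _ PE.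
  by apply: nPE; rewrite PE subsetDl.
have leK : #|K| <= N * #|shadow K|.
  rewrite leqNgt; apply/negP => /minL'/(_ KL') KE.
  by move: ltK; rewrite KE ltnn.
nia.
Qed.

(** Take a member above [Y] that meets [Z] outside [Y] as little as possible. If it still did so at
    [x], richness would allow [x] to be exchanged for a vertex outside [Z]. *)
Lemma rich_expandable (X : finType) (k N : nat) (L : {set {set X}})
    (D Y : {set X}) :
  is_uniform k L ->
  (forall D x, D \in L -> x \in D -> N < codegree L (D :\ x)) ->
  D \in L -> Y \subset D -> expandable L N Y.
Proof.
move=> uL richL DL YD Z leZ.
have PD : (D \in L) && (Y \subset D) by rewrite DL.
case: (@arg_minnP _ D (fun E => (E \in L) && (Y \subset E))
  (fun E => #|(E :&: Z) :\: Y|) PD).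
move=> E /andP[EL YE] minE; exists E; rewrite // YE -setD_eq0 /=.
apply/set0Pn => -[x]; rewrite !inE => /and3P[xY xE xZ].
case: k uL => [uL|k uL].
  by move: xE; have /eqP := uniform_card uL EL; rewrite cards_eq0 => /eqP->; rewrite inE.
have cE : #|E :\ x| = k.
  by have := uniform_card uL EL; rewrite (cardsD1 x) xE add1n => -[].
have [E' E'L /andP[sE E'Z]] := codegree_expandable uL cE (richL E x EL xE) leZ.
have sY : Y \subset E :\ x.
  by rewrite subsetD1 YE xY.
have := minE E'; rewrite E'L (subset_trans sY sE) => /(_ isT).
apply/negP; rewrite -ltnNge; apply/proper_card/properP; split.
  apply/subsetP => y; rewrite !inE => /and3P[-> yE' yZ].
  have : y \in E :\ x by apply: (subsetP E'Z); rewrite inE yE'.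
  by rewrite !inE => /andP[_ ->].
exists x; rewrite ?inE ?xY ?xE //=.
apply/negP => /andP[xE' _]; have : x \in E :\ x.
  by apply: (subsetP E'Z); rewrite inE xE'.
by rewrite !inE eqxx.
Qed.

(** * Greedy embedding of trees *)

Lemma extend_injection (W X : finType) (f : W -> X) (C A : {set W})
    (B : {set X}) :
  {in C &, injective f} -> [disjoint A & C] -> #|A| <= #|B| ->
  [disjoint B & f @: C] ->
  exists f' : W -> X, [/\ {in C, f' =1 f}, {in C :|: A &, injective f'} &
    {in A, forall w, f' w \in B}].
Proof.
move=> injf dAC leAB dBf.
pose h w := nth (f w) (enum B) (index w (enum A)).
have idx w : w \in A -> index w (enum A) < size (enum B).
  move=> wA; rewrite -cardE (leq_trans _ leAB) // cardE index_mem.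
  by rewrite mem_enum.
have hB w : w \in A -> h w \in B.
  by move=> wA; rewrite -mem_enum mem_nth // idx.
have hinj : {in A &, injective h}.
  move=> w w' wA w'A; rewrite /h (set_nth_default (f w')) ?idx //.
  move/eqP; rewrite nth_uniq ?idx ?enum_uniq // => /eqP e.
  by apply: (index_inj w _ _ e); rewrite mem_enum.
have CA w : w \in C -> (w \in A) = false.
  by move=> wC; apply: (disjointFl dAC).
have neq w w' : w \in A -> w' \in C -> h w <> f w'.
  move=> wA w'C /esym e; move: (disjointFr dBf (hB w wA)).
  by rewrite -e imset_f.
exists (fun w => if w \in A then h w else f w); split.
- by move=> w wC; rewrite (CA w wC).
- move=> w w'; rewrite !inE; case: ifP => wA; case: ifP => w'A; rewrite ?orbT ?orbF.
  + by move=> _ _; apply: hinj.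
  + by move=> _ w'C /neq; case.
  + by move=> wC _ /esym/neq; case.
  + exact: injf.
- by move=> w wA; rewrite wA hB.
Qed.

(** The part of [K m] that is already placed lies in one earlier edge, hence inside a member of [L],
    and is therefore expandable: some member contains it and meets the image nowhere else, which
    leaves room for the rest of [K m]. As [K m] may have fewer than [k] vertices, images are only
    contained in members. *)
Lemma tree_embedding (W X : finType) (x0 : X) (k m : nat) (K : nat -> {set W})
    (L : {set {set X}}) :
  is_uniform k L -> L != set0 ->
  (forall D x, D \in L -> x \in D -> #|W| < codegree L (D :\ x)) ->
  (forall i, i < m -> #|K i| <= k) ->
  (forall i, 0 < i < m -> exists2 a, a < i & K i :&: \bigcup_(j < i) K j \subset K a) ->
  exists f : W -> X, {in \bigcup_(j < m) K j &, injective f} /\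
    forall i, i < m -> exists2 D, D \in L & f @: K i \subset D.
Proof.
move=> uL /set0Pn[D0 D0L] richL; elim: m => [|m IHm] leK treeK.
  by exists (fun=> x0); split=> // w w'; rewrite big_ord0 inE.
have [i im|i /andP[i0 im]|f [injf fL]] := IHm; first exact: leK (ltnW im).
  by apply: treeK; rewrite i0 ltnW.
set C := \bigcup_(j < m) K j in injf *.
have sKC i : i < m -> K i \subset C.
  by move=> im; apply: (bigcup_sup (Ordinal im)).
set Y := f @: (K m :&: C).
have cY : #|Y| = #|K m :&: C|.
  by apply: card_in_imset => w w' /setIP[_ wC] /setIP[_ w'C]; apply: injf.
have [D DL YD] : exists2 D, D \in L & Y \subset D.
  case: (posnP m) => [m0|m_gt0].
    exists D0; rewrite // /Y /C m0; apply/subsetP => x /imsetP[w].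
    by rewrite big_ord0 !inE andbF.
  have [|a am sKa] := treeK m; first by rewrite m_gt0 ltnSn.
  have [D DL fD] := fL a am; exists D => //.
  exact: subset_trans (imsetS _ sKa) fD.
have [|D' D'L /andP[YD' D'Z]] := rich_expandable uL richL DL YD (Z := f @: C).
  by rewrite (leq_trans (leq_imset_card _ _)) ?max_card.
have [|||f' [f'f injf' f'B]] := @extend_injection W X f C (K m :\: C) (D' :\: Y) injf.
- by rewrite disjoint_sym disjoints_subset; apply/subsetP => w wC; rewrite !inE wC.
- have := cardsID C (K m); have := cardsID Y D'; rewrite (setIidPr YD') cY.
  by have := leK m (ltnSn m); rewrite (uniform_card uL D'L); lia.
- rewrite disjoints_subset; apply/subsetP => x; rewrite !inE => /andP[xY xD'].
  by apply: contra xY => xf; apply: (subsetP D'Z); rewrite inE xD'.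
exists f'; split.
  rewrite big_ord_recr /= -/C (_ : C :|: K m = C :|: (K m :\: C)) //.
  by apply/setP => w; rewrite !inE; case: (w \in C).
move=> i; rewrite ltnS leq_eqVlt => /orP[/eqP->|im].
  exists D' => //; apply/subsetP => _ /imsetP[w wK ->].
  have [wC|wC] := boolP (w \in C); last first.
    by have := f'B w; rewrite !inE wC wK => /(_ isT)/andP[].
  by rewrite f'f //; apply: (subsetP YD'); apply: imset_f; rewrite inE wK.
have [D1 D1L fD1] := fL i im; exists D1 => //.
rewrite (_ : f' @: K i = f @: K i) //; apply: eq_in_imset => w wK.
by apply: f'f; apply: (subsetP (sKC i im)).
Qed.

(** Deleting [U] from every edge keeps the tree order valid, so the trimmed edges can be placed
    greedily inside a rich subfamily of [L]. *)
Lemma hypertree_embedding (W X : finType) (k : nat) (T : seq {set W})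
    (U : {set W}) (L : {set {set X}}) :
  hypertree T -> (forall E, E \in T -> #|E :\: U| <= k.+1) ->
  is_uniform k.+1 L -> #|W| * #|shadow L| < #|L| ->
  exists f : W -> X, {in (\bigcup_(E in T) E) :\: U &, injective f} /\
    forall E, E \in T -> exists2 D, D \in L & f @: (E :\: U) \subset D.
Proof.
move=> [s sT trees] leT uL /rich_subfamily[L' [sL' L'0 richL']].
have uL' := uniformS sL' uL.
have [x0 _] : exists x0 : X, true.
  have /set0Pn[D DL'] := L'0; have := uniform_card uL' DL'.
  by case: (set_0Vmem D) => [->|[x _]]; [rewrite cards0|exists x].
have nths E : E \in T -> exists2 i, i < size s & E = nth set0 s i.
  by rewrite -(perm_mem sT) => /(nthP set0)[i]; exists i.
have [i im|i im|f [injf fL]] :=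
  @tree_embedding W X x0 k.+1 (size s) (fun i => nth set0 s i :\: U) L' uL' L'0 richL'.
- by apply: leT; rewrite -(perm_mem sT) mem_nth.
- have [a ai sa] := trees i im; exists a => //; apply/subsetP => w.
  rewrite !inE => /andP[/andP[wU wi] /bigcupP[j _]]; rewrite !inE wU /= => wj.
  by apply: (subsetP sa); rewrite inE wi; apply/bigcupP; exists j.
exists f; split.
  suff sC : (\bigcup_(E in T) E) :\: U \subset \bigcup_(j < size s) (nth set0 s j :\: U).
    by move=> w w' /(subsetP sC) wC /(subsetP sC); apply: injf.
  apply/subsetP => w; rewrite !inE => /andP[wU /bigcupP[E /nths[i im ->] wi]].
  by apply/bigcupP; exists (Ordinal im) => //; rewrite inE wU.
move=> E /nths[i im ->]; have [D DL' fD] := fL i im.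
by exists D => //; apply: (subsetP sL').
Qed.

(** No vertex of [U] is shared by different edges, so the edges can be completed one after the
    other: expandability of the core yields an edge of [F] that avoids everything else placed
    before, and the leaves go to its remaining vertices. *)
Lemma leaf_extension (W X : finType) (r : nat) (T : seq {set W}) (U : {set W})
    (F : {set {set X}}) (f : W -> X) :
  is_uniform r [in T] -> is_uniform r F ->
  (forall u E E', u \in U -> E \in T -> E' \in T -> u \in E -> u \in E' -> E = E') ->
  {in (\bigcup_(E in T) E) :\: U &, injective f} ->
  (forall E, E \in T -> expandable F #|W| (f @: (E :\: U))) ->
  exists f' : W -> X, {in \bigcup_(E in T) E &, injective f'} /\
    forall E, E \in T -> f' @: E \in F.
Proof.
move=> uT uF leafU; set C := \bigcup_(E in T) E => injf expf.
have sEC E : E \in T -> E \subset C by move=> ET; apply: bigcup_sup.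
suff partial (T1 : seq {set W}) : {subset T1 <= T} ->
    exists f' : W -> X, [/\ {in C :\: U, f' =1 f},
      {in (C :\: U) :|: \bigcup_(E in T1) E &, injective f'} &
      forall E, E \in T1 -> f' @: E \in F].
  have [f' [_ injf' f'F]] := partial T (fun _ => id).
  by exists f'; split=> // w w' wC w'C; apply: injf'; rewrite inE ?wC ?w'C orbT.
elim: T1 => [_|E T1 IH sT1].
  exists f; split=> // w w'.
  by rewrite big_pred0 ?setU0 => [|E]; [apply: injf|rewrite in_nil].
have [|f' [f'f injf' f'F]] := IH; first by move=> E' E'1; apply: sT1; rewrite inE E'1 orbT.
have ET : E \in T by apply: sT1; rewrite inE eqxx.
set Dm := _ :|: _ in injf'.
have eqb : (C :\: U) :|: \bigcup_(E' in E :: T1) E' = Dm :|: E.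
  apply/setP => w; rewrite !inE -!orbA; congr orb; apply/bigcupP/orP.
    case=> E'; rewrite inE => /predU1P[->|E'1] wE'; first by right.
    by left; apply/bigcupP; exists E'.
  case=> [/bigcupP[E' E'1 wE']|wE]; last by exists E; rewrite // inE eqxx.
  by exists E'; rewrite // inE E'1 orbT.
(* [T] may list an edge twice; a repeated edge has been completed already. *)
have [E1|nE1] := boolP (E \in T1).
  exists f'; split=> // [|E']; last by rewrite inE => /predU1P[->|]; apply: f'F.
  rewrite eqb (setUidPl _) //; apply: subset_trans (subsetUr _ _).
  exact: bigcup_sup.
have EDm w : w \in E -> (w \in Dm) = (w \notin U).
  move=> wE; apply/idP/idP => [|wU]; last first.
    by rewrite 2!inE wU (subsetP (sEC E ET)).
  rewrite 2!inE => /orP[/andP[]//|/bigcupP[E' E'1 wE']].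
  apply/negP => wU; case/negP: nE1.
  by rewrite (leafU w E E' wU ET _ wE wE') // sT1 // inE E'1 orbT.
have f'E : f' @: (E :\: U) = f @: (E :\: U).
  apply: eq_in_imset => w; rewrite inE => /andP[wU wE].
  by apply: f'f; rewrite inE wU (subsetP (sEC E ET)).
have [|F1 F1F /andP[QF1 F1Z]] := expf E ET (f' @: Dm).
  by rewrite (leq_trans (leq_imset_card _ _)) ?max_card.
set Q := f @: (E :\: U) in f'E QF1 F1Z.
have cQ : #|Q| = #|E :\: U|.
  rewrite -f'E card_in_imset // => w w' /setDP[wE wU] /setDP[w'E w'U].
  by apply: injf'; rewrite EDm.
have [|||f2 [f2f' injf2 f2B]] := @extend_injection W X f' Dm (E :&: U) (F1 :\: Q) injf'.
- by rewrite disjoints_subset; apply/subsetP => w /setIP[wE wU]; rewrite in_setC EDm ?wU.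
- have := cardsID U E; have := cardsID Q F1; rewrite (setIidPr QF1) cQ.
  by rewrite (uniform_card uF F1F) (uniform_card uT ET); lia.
- rewrite disjoints_subset; apply/subsetP => x; rewrite !inE => /andP[xQ xF1].
  by apply: contra xQ => xf; apply: (subsetP F1Z); rewrite inE xF1.
have eqDm : Dm :|: E :&: U = Dm :|: E.
  apply/setP => w; rewrite [LHS]in_setU [RHS]in_setU in_setI.
  by have [wE|wE] := boolP (w \in E); rewrite /= ?andbF // EDm //; case: (w \in U).
rewrite eqDm in injf2; exists f2; split.
- by move=> w wC; rewrite f2f' ?f'f // inE wC.
- by rewrite eqb.
move=> E'; rewrite inE => /predU1P[->|E'1]; last first.
  rewrite (_ : f2 @: E' = f' @: E') ?f'F //; apply: eq_in_imset => w wE'.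
  by apply: f2f'; rewrite inE; apply/orP; right; apply/bigcupP; exists E'.
suff -> : f2 @: E = F1 by [].
apply/eqP; rewrite eqEcard; apply/andP; split; last first.
  rewrite card_in_imset ?(uniform_card uF F1F) ?(uniform_card uT ET) // => w w' wE w'E.
  by apply: injf2; rewrite inE ?wE ?w'E orbT.
apply/subsetP => _ /imsetP[w wE ->]; have [wU|wU] := boolP (w \in U).
  by have := f2B w; rewrite !inE wE wU => /(_ isT)/andP[].
rewrite f2f' ?EDm //; apply: (subsetP QF1); rewrite -f'E.
by apply: imset_f; rewrite inE wU.
Qed.

(** Isolated vertices of [H] may be sent outside all edges of [T], where [f] need not be injective.
    So [f] is redefined there, which takes [#|W| <= #|X|]. *)
Lemma embeddable_trans (V W X : finType) (H : {set {set V}}) (T : seq {set W})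
    (F : {set {set X}}) (f : W -> X) :
  #|W| <= #|X| -> embeddable H [in T] ->
  {in \bigcup_(E in T) E &, injective f} ->
  (forall E, E \in T -> f @: E \in F) -> embeddable H F.
Proof.
move=> leWX /existsP[g /andP[/injectiveP injg /forall_inP gT]].
set C := \bigcup_(E in T) E => injf fF.
have [|||f' [f'f injf' _]] := @extend_injection W X f C (~: C) (~: (f @: C)) injf.
- by rewrite disjoints_subset.
- by have := cardsC C; have := cardsC (f @: C); rewrite (card_in_imset injf); lia.
- by rewrite disjoints_subset.
rewrite setUCr in injf'.
apply/existsP; exists [ffun v => f' (g v)]; apply/andP; split.
  by apply/injectiveP => v v'; rewrite !ffunE => /injf' -/(_ (in_setT _) (in_setT _))/injg.
apply/forall_inP => E EH; have := fF _ (gT E EH).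
rewrite -imset_comp (_ : (_ @: E) = [ffun v => f' (g v)] @: E) //.
apply: eq_in_imset => v vE; rewrite ffunE /= f'f //.
by apply/bigcupP; exists (g @: E); [apply: gT|apply: imset_f].
Qed.

(** The number of leaves depends on the edge because [card_common_links] takes a leaf only from the
    edges that miss the crosscut. *)
Lemma leaf_set (W : finType) (k : nat) (T : seq {set W}) (m : {set W} -> nat) :
  reducible k T -> (forall E, E \in T -> m E <= k) ->
  exists U : {set W},
    (forall u E E', u \in U -> E \in T -> E' \in T -> u \in E -> u \in E' -> E = E') /\
    forall E, E \in T -> #|E :&: U| = m E.
Proof.
move=> /allP redT lem; pose leaves (E : {set W}) := [set v in E | degree T v == 1].
pose h (E : {set W}) := [set x in take (m E) (enum (leaves E))].
have hE E u : u \in h E -> u \in E /\ degree T u = 1.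
  by rewrite inE => /mem_take; rewrite mem_enum inE => /andP[-> /eqP].
have leafE u E E' : degree T u = 1 -> E \in T -> E' \in T -> u \in E -> u \in E' -> E = E'.
  move=> du ET E'T uE uE'; apply/eqP; apply: contraT => nEE'.
  have : size [:: E; E'] <= degree T u.
    rewrite /degree -size_filter; apply: uniq_leq_size; first by rewrite /= inE nEE'.
    by move=> E1; rewrite !inE mem_filter => /orP[]/eqP->; rewrite ?uE ?uE'.
  by rewrite du.
exists (\bigcup_(E in T) h E); split.
  by move=> u E E' /bigcupP[E1 _ /hE[_ du]]; apply: leafE.
move=> E ET; rewrite (_ : _ :&: _ = h E); last first.
  apply/setP => u; rewrite inE; apply/andP/idP => [[uE /bigcupP[E1 E1T uh]]|uh].
    by have [uE1 du] := hE _ _ uh; rewrite (leafE u E E1).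
  by split; [case: (hE _ _ uh)|apply/bigcupP; exists E].
rewrite cardsE; have /card_uniqP -> := take_uniq (m E) (enum_uniq (leaves E)).
by rewrite size_takel // -cardE (leq_trans (lem E ET)) // redT.
Qed.

(** The cores [E :\: U] are as large as the members of [L], so their images are members themselves
    and thus expandable in [F], which makes room for the leaves. *)
Lemma embeddable_of_cores (V W X : finType) (r k : nat) (H : {set {set V}})
    (T : seq {set W}) (U : {set W}) (L F : {set {set X}}) :
  rtree r T ->
  (forall u E E', u \in U -> E \in T -> E' \in T -> u \in E -> u \in E' -> E = E') ->
  (forall E, E \in T -> #|E :\: U| = k.+1) ->
  embeddable H [in T] -> is_uniform r F -> is_uniform k.+1 L ->
  (forall Q, Q \in L -> expandable F #|W| Q) ->
  #|W| <= #|X| -> #|W| * #|shadow L| < #|L| -> embeddable H F.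
Proof.
move=> [uT treeT] leafU cU embH uF uL expL leWX ltL.
have [|f [injf fL]] := hypertree_embedding treeT _ uL ltL (U := U).
  by move=> E ET; rewrite cU.
have [|f' [injf' f'F]] := leaf_extension uT uF leafU injf.
  move=> E ET; have [D DL fD] := fL E ET.
  suff -> : f @: (E :\: U) = D by apply: expL.
  apply/eqP; rewrite eqEcard fD (uniform_card uL DL) card_in_imset ?cU ?leqnn //.
  move=> w w' /setDP[wE wU] /setDP[w'E w'U]; apply: injf; rewrite inE ?wU ?w'U.
    by apply/bigcupP; exists E.
  by apply/bigcupP; exists E.
exact: embeddable_trans leWX embH injf' f'F.
Qed.

(** * Degrees, links and a Kruskal-Katona bound *)

Lemma card_bigcup_leq (I X : finType) (A : pred I) (G : I -> {set X}) :
  #|\bigcup_(i | A i) G i| <= \sum_(i | A i) #|G i|.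
Proof.
elim/big_rec2: _ => [|i B n _ leB]; first by rewrite cards0.
by rewrite (leq_trans (leq_card_setU _ _)) // leq_add2l.
Qed.

Lemma sum_degree (X : finType) (k : nat) (L : {set {set X}}) :
  is_uniform k L -> \sum_x #|[set D in L | x \in D]| = k * #|L|.
Proof.
move=> uL; transitivity (\sum_x \sum_(D in L) (x \in D : nat)).
  apply: eq_bigr => x _; rewrite -sum1dep_card -big_mkcondr /=.
  by apply: eq_bigl => D.
rewrite exchange_big /= mulnC -sum_nat_const; apply: eq_bigr => D DL.
by rewrite -(uniform_card uL DL) -sum1_card [RHS]big_mkcond; apply: eq_bigr => x _; case: ifP.
Qed.

Definition link (X : finType) (L : {set {set X}}) (x : X) : {set {set X}} :=
  [set D :\ x | D in L & x \in D].

Lemma card_link (X : finType) (L : {set {set X}}) (x : X) :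
  #|link L x| = #|[set D in L | x \in D]|.
Proof.
rewrite /link card_in_imset; first by apply: eq_card => D; rewrite !inE.
move=> D D'; rewrite !inE => /andP[_ xD] /andP[_ xD'] /(congr1 (setU [set x])).
by rewrite !setD1K.
Qed.

Lemma link_uniform (X : finType) (k : nat) (L : {set {set X}}) (x : X) :
  is_uniform k.+1 L -> is_uniform k (link L x).
Proof.
move=> uL; apply/forall_inP => _ /imsetP[D /setIdP[DL xD] ->].
by have := uniform_card uL DL; rewrite (cardsD1 x) xD add1n => -[->].
Qed.

Lemma card_shadow_link (X : finType) (L : {set {set X}}) (x : X) :
  #|shadow (link L x)| <= #|[set P in shadow L | x \in P]|.
Proof.
have xl P : P \in shadow (link L x) -> x \notin P /\ x |: P \in shadow L.
  move=> /imset2P[_ y /imsetP[D /setIdP[DL xD] ->]]; rewrite !inE => /andP[yx yD] ->.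
  split; first by rewrite !inE eqxx andbF.
  rewrite (_ : _ |: _ = D :\ y) ?mem_shadow //.
  apply/setP => z; rewrite !inE; have [->|//] := eqVneq z x.
  by rewrite xD eq_sym yx.
rewrite -(card_in_imset (f := fun P => x |: P)) => [|P P' /xl[xP _] /xl[xP' _]].
  apply/subset_leq_card/subsetP => _ /imsetP[P /xl[_ xPs] ->].
  by rewrite inE xPs !inE eqxx.
by move/(congr1 (fun A => A :\ x)); rewrite !setU1K.
Qed.

(* A form of the Kruskal-Katona bound [#|L| ^ k <= #|shadow L| ^ k.+1] which is
   stable under passing to links: a link with a small shadow is handled by
   induction, and any link is at most as large as the shadow. *)
Lemma card_leq_shadow (X : finType) (k t : nat) (L : {set {set X}}) :
  is_uniform k.+1 L -> #|shadow L| < t ^ k -> #|L| <= t * #|shadow L|.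
Proof.
elim: k L => [|k IHk] L uL lts.
  have [->|[D DL]] := set_0Vmem L; first by rewrite cards0.
  have [D0|[x xD]] := set_0Vmem D; first by have := uniform_card uL DL; rewrite D0 cards0.
  by move: lts; rewrite expn0 ltnS leqNgt card_gt0; case/set0Pn; exists (D :\ x); apply: mem_shadow.
have deg x : #|[set D in L | x \in D]| <= t * #|[set P in shadow L | x \in P]|.
  rewrite -card_link; apply: leq_trans (leq_mul (leqnn t) (card_shadow_link L x)).
  have [|lets] := ltnP #|shadow (link L x)| (t ^ k).
    exact: IHk (link_uniform x uL).
  apply: leq_trans (leq_mul (leqnn t) lets); rewrite -expnS.
  apply: leq_trans (ltnW lts); apply/subset_leq_card/subsetP => _ /imsetP[D /setIdP[DL xD] ->].
  exact: mem_shadow.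
(* Summed over [x], the degrees give [k.+2 * #|L|] on the left, but only [k.+1 * #|shadow L|] on the
   right. *)
have : k.+2 * #|L| <= k.+2 * (t * #|shadow L|).
  rewrite -(sum_degree uL) (leq_trans (leq_sum _ (fun x _ => deg x))) //.
  by rewrite -big_distrr /= (sum_degree (shadow_uniform uL)) mulnCA leq_mul2r leqnSn orbT.
by rewrite leq_pmul2l.
Qed.

(** * Edges with two poor subsets, and rich sets *)

Definition two_poor (X : finType) (F : {set {set X}}) (N : nat) : {set {set X}} :=
  [set E in F | [exists a in E, exists b in E, [&& a != b,
      codegree F (E :\ a) <= N & codegree F (E :\ b) <= N]]].

(* The (r-2)-sets [Q = E - {a, b}] arising from many edges [E] are expandable,
   because no further vertex lies in more than [N] of these edges; so they
   cannot be numerous enough to carry the tree with two leaves removed from each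
   edge. *)
Lemma card_two_poor (V W X : finType) (k : nat) (H : {set {set V}})
    (T : seq {set W}) (F : {set {set X}}) :
  rtree k.+3 T -> reducible 2 T -> embeddable H [in T] -> is_uniform k.+3 F ->
  #|W| <= #|X| -> ~~ embeddable H F ->
  #|two_poor F #|W| | <= 2 * #|W| ^ 2 * #|X| ^ k.+1.
Proof.
move=> trT redT embH uF leWX nembF; set N := #|W|.
have [U [leafU cU]] := leaf_set redT (m := fun=> 2) (fun _ _ => leqnn _).
have cores E : E \in T -> #|E :\: U| = k.+1.
  move=> ET; have := cardsID U E; rewrite (cU E ET).
  by case: trT => uT _; rewrite (uniform_card uT ET); lia.
set G := two_poor F N.
pose good (E : {set X}) (p : X * X) := [&& p.1 \in E, p.2 \in E, p.1 != p.2,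
  codegree F (E :\ p.1) <= N & codegree F (E :\ p.2) <= N].
(* One pair is chosen per edge, so each edge of [G] has a single core; the default [E] never occurs
   on [G]. *)
pose q (E : {set X}) := if [pick p | good E p] is Some p then E :\ p.1 :\ p.2 else E.
have qP E : E \in G -> exists2 p, good E p & q E = E :\ p.1 :\ p.2.
  rewrite inE => /andP[EF /existsP[a /andP[aE /existsP[b /andP[bE ab]]]]].
  rewrite /q; case: pickP => [p gp|/(_ (a, b))]; first by exists p.
  by rewrite /good /= aE bE ab.
have GF E : E \in G -> E \in F by rewrite inE => /andP[].
pose GQ (Q : {set X}) := [set E in G | q E == Q].
(* These edges all contain [z |: Q]. For any one of them, [E0], this set is [E0] minus one vertex of
   its chosen pair, hence poor. *)
have fib (Q : {set X}) z : z \notin Q -> #|[set E in GQ Q | z \in E]| <= N.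
  move=> zQ; have [->|[E0]] := set_0Vmem [set E in GQ Q | z \in E]; first by rewrite cards0.
  move=> /setIdP[/setIdP[E0G /eqP qE0] zE0].
  have qE E : E \in G -> q E \subset E.
    by move=> /qP[p _ ->]; rewrite (subset_trans (subsetDl _ _)) ?subsetDl.
  apply: leq_trans (_ : codegree F (z |: Q) <= N).
    apply/subset_leq_card/subsetP => E /setIdP[/setIdP[EG /eqP EQ] zE].
    by rewrite inE GF // subUset sub1set zE -EQ qE.
  have [p /and5P[p1 p2 p12 d1 d2]] := qP E0 E0G.
  rewrite qE0 => QE0; move: zQ; rewrite QE0 !inE zE0 andbT negb_and !negbK => /orP[]/eqP->.
    rewrite (_ : _ |: _ = E0 :\ p.1) //; apply/setP => w; rewrite !inE.
    by have [->|//] := eqVneq w p.2; rewrite p2 eq_sym p12.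
  rewrite (_ : _ |: _ = E0 :\ p.2) //; apply/setP => w; rewrite !inE.
  by have [->|] := eqVneq w p.1; rewrite ?p1 ?p12 //.
have meet (Q Z : {set X}) : #|[set E in GQ Q | ~~ (E :&: Z \subset Q)]| <= #|Z| * N.
  apply: leq_trans (_ : #|\bigcup_(z in Z :\: Q) [set E in GQ Q | z \in E]| <= _).
    apply/subset_leq_card/subsetP => E /setIdP[EQ /subsetPn[z]].
    by rewrite inE => /andP[zE zZ] zQ; apply/bigcupP; exists z; rewrite inE ?zQ ?EQ.
  rewrite (leq_trans (card_bigcup_leq _ _)) //.
  apply: leq_trans (_ : \sum_(z in Z :\: Q) N <= _).
    by apply: leq_sum => z /setDP[_ zQ]; apply: fib.
  by rewrite sum_nat_const leq_mul // subset_leq_card // subsetDl.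
have uq : is_uniform k.+1 (q @: G).
  apply/forall_inP => _ /imsetP[E EG ->]; have [p /and5P[p1 p2 p12 _ _] ->] := qP E EG.
  have := uniform_card uF (GF E EG); rewrite (cardsD1 p.1) p1 (cardsD1 p.2) !inE.
  by rewrite eq_sym p12 p2 !add1n => -[->].
have qN (Q : {set X}) : Q \in q @: G -> #|GQ Q| <= #|X| * N.
  move=> /imsetP[E0 E0G ->]; rewrite -cardsT (leq_trans _ (meet (q E0) setT)) //.
  apply/subset_leq_card/subsetP => E EQ; rewrite inE EQ setIT.
  case/setIdP: EQ => EG /eqP <-; apply/negP => /subset_leq_card.
  by rewrite (uniform_card uF (GF E EG)) (uniform_card uq) ?imset_f //; lia.
pose QQ := [set Q in q @: G | N * N < #|GQ Q|].
have uQQ : is_uniform k.+1 QQ.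
  by apply: uniformS uq; apply/subsetP => Q; rewrite inE => /andP[].
have leQQ : #|QQ| <= N * #|X| ^ k.
  have := uniform_leq_exp (shadow_uniform uQQ) => lesh.
  apply: leq_trans (leq_mul (leqnn N) lesh); rewrite leqNgt; apply: contra nembF.
  apply: embeddable_of_cores trT leafU cores embH uF uQQ _ leWX.
  move=> Q; rewrite inE => /andP[_ ltQ] Z leZ.
  have [E] : exists2 E, E \in GQ Q & E :&: Z \subset Q.
    apply/exists_inP/contraT => /exists_inPn allE.
    have : #|GQ Q| <= #|Z| * N.
      apply: leq_trans (meet Q Z); apply/subset_leq_card/subsetP => E EQ.
      by rewrite inE EQ allE.
    by rewrite leqNgt (leq_ltn_trans _ ltQ) // leq_mul.
  move=> /setIdP[EG /eqP qE] EZ; exists E; rewrite ?GF // EZ andbT -qE.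
  by have [p _ ->] := qP E EG; rewrite (subset_trans (subsetDl _ _)) ?subsetDl.
rewrite -sum1_card (partition_big_imset q) /=.
(* There are at most [#|X| ^ k.+1] cores, and those outside [QQ] carry at most [N * N] edges each.
   The at most [N * #|X| ^ k] cores in [QQ] carry at most [#|X| * N] edges each. The two parts have
   the same bound, whence the factor 2. *)
apply: leq_trans (_ : \sum_(Q in q @: G) (N * N + (Q \in QQ) * (#|X| * N)) <= _).
  apply: leq_sum => Q QG; rewrite sum1dep_card -/(GQ Q).
  rewrite inE QG /=; case: (ltnP (N * N)) => [_|leN]; last by rewrite mul0n addn0.
  by rewrite mul1n (leq_trans (qN Q QG)) // leq_addl.
rewrite big_split /= sum_nat_const -big_distrl /= -big_mkcondr /= sum1_card.
have -> : #|[pred Q | (Q \in q @: G) && (Q \in QQ)]| = #|QQ|.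
  by apply: eq_card => Q; rewrite !inE andbA andbb.
have := uniform_leq_exp uq => leq1.
rewrite (leq_trans (leq_add (leq_mul leq1 (leqnn _)) (leq_mul leQQ (leqnn _)))) //.
by rewrite (mulnC #|X|) mulnACA -expnSr mulnC addnn -mul2n mulnn mulnA leqnn.
Qed.

Definition rich_sets (X : finType) (F : {set {set X}}) (k N : nat) : {set {set X}} :=
  [set P : {set X} | (#|P| == k) && (N < codegree F P)].

Lemma card_rich_sets (V W X : finType) (k : nat) (H : {set {set V}})
    (T : seq {set W}) (F : {set {set X}}) :
  rtree k.+3 T -> reducible 2 T -> embeddable H [in T] -> is_uniform k.+3 F ->
  #|W| <= #|X| -> ~~ embeddable H F ->
  #|rich_sets F k.+2 #|W| | <= #|W| * #|X| ^ k.+1.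
Proof.
move=> trT redT embH uF leWX nembF.
have [U [leafU cU]] := leaf_set redT (m := fun=> 1) (fun _ _ => isT).
have cores E : E \in T -> #|E :\: U| = k.+2.
  move=> ET; have := cardsID U E; rewrite (cU E ET).
  by case: trT => uT _; rewrite (uniform_card uT ET); lia.
have uR : is_uniform k.+2 (rich_sets F k.+2 #|W|).
  by apply/forall_inP => P; rewrite inE => /andP[].
apply: leq_trans (leq_mul (leqnn _) (uniform_leq_exp (shadow_uniform uR))).
rewrite leqNgt; apply: contra nembF.
apply: (embeddable_of_cores trT leafU cores embH uF uR _ leWX).
by move=> P; rewrite inE => /andP[/eqP cP ltP]; apply: codegree_expandable uF cP ltP.
Qed.

(** * Centers of edges and their links *)

Definition center (X : finType) (F : {set {set X}}) (N : nat) (E : {set X}) (x : X) : bool :=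
  (x \in E) && [forall a in E, (a != x) ==> (N < codegree F (E :\ a))].

Definition center_link (X : finType) (F : {set {set X}}) (N : nat) (x : X) : {set {set X}} :=
  link [set E in F | center F N E x] x.

Lemma center_linkP (X : finType) (F : {set {set X}}) (N : nat) (x : X) (D : {set X}) :
  D \in center_link F N x -> x \notin D /\ x |: D \in F.
Proof.
by move=> /imsetP[E /setIdP[/setIdP[EF _] xE] ->]; rewrite setD1K // !inE eqxx.
Qed.

Lemma center_link_uniform (X : finType) (k N : nat) (F : {set {set X}}) (x : X) :
  is_uniform k.+1 F -> is_uniform k (center_link F N x).
Proof.
move=> uF; apply/link_uniform/(uniformS _ uF).
by apply/subsetP => E /setIdP[].
Qed.

(** If [E :\ x] is poor and [E] is not in [two_poor F N], then [x] is a center; if no such set is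
    poor, every vertex is. Edges with several centers are counted repeatedly, which is harmless in
    an upper bound. *)
Lemma card_leq_center_links (X : finType) (k N : nat) (F : {set {set X}}) :
  is_uniform k.+1 F ->
  #|F| <= #|two_poor F N| + \sum_x #|center_link F N x|.
Proof.
move=> uF; rewrite -(cardsID (two_poor F N) F).
apply: leq_add; first by rewrite subset_leq_card // subsetIr.
apply: leq_trans (_ : #|\bigcup_x [set E in [set E in F | center F N E x] | x \in E]| <= _).
  apply/subset_leq_card/subsetP => E /setDP[EF]; rewrite inE EF => ntwo.
  suff [x cx] : exists x, center F N E x.
    by apply/bigcupP; exists x => //; rewrite !inE EF cx; case/andP: cx.
  have [/exists_inP[x xE dx]|/exists_inPn rich] :=
      boolP [exists x in E, codegree F (E :\ x) <= N].
    exists x; rewrite /center xE; apply/forall_inP => a aE; apply/implyP => ax.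
    rewrite ltnNge; apply: contra ntwo => da; apply/exists_inP; exists a => //.
    by apply/exists_inP; exists x => //; rewrite ax da dx.
  have [E0|[x xE]] := set_0Vmem E; first by have := uniform_card uF EF; rewrite E0 cards0.
  exists x; rewrite /center xE; apply/forall_inP => a aE; apply/implyP => _.
  by rewrite ltnNge rich.
apply: (leq_trans (card_bigcup_leq _ _)); apply/eq_leq/eq_big => // x _.
by rewrite /center_link card_link.
Qed.

(** Adding [x] to a shadow member of its center link gives some [E :\ a] with [a != x], which is
    rich as [x] is a center. Each rich set arises in this way from its [k] vertices only. *)
Lemma sum_shadow_center_links (X : finType) (k N : nat) (F : {set {set X}}) :
  is_uniform k.+1 F ->
  \sum_x #|shadow (center_link F N x)| <= k * #|rich_sets F k N|.
Proof.
move=> uF; have uR : is_uniform k (rich_sets F k N).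
  by apply/forall_inP => P; rewrite inE => /andP[].
rewrite -(sum_degree uR); apply: leq_sum => x _.
apply: (leq_trans (card_shadow_link _ _)); apply/subset_leq_card/subsetP => P.
move=> /setIdP[/imset2P[E a /setIdP[EF /andP[xE /forall_inP richE]] aE ->]].
rewrite !inE => /andP[xa _]; rewrite (eq_sym x) in xa.
rewrite xE (eq_sym x) xa (implyP (richE a aE)) // !andbT.
by have := uniform_card uF EF; rewrite (cardsD1 a) aE add1n => -[->].
Qed.

(* The crosscut [S] is mapped to [B]. Removing from the tree the image of [S],
   and one leaf of each edge missing this image, leaves cores of size at most
   r-1 which embed into [L]. *)
Lemma card_common_links (V W X : finType) (k : nat) (H : {set {set V}})
    (T : seq {set W}) (S : {set V}) (B : {set X}) (L F : {set {set X}}) :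
  rtree k.+3 T -> reducible 1 T -> embeddable H [in T] -> crosscut H S ->
  #|S| <= #|B| -> is_uniform k.+2 L ->
  (forall D x, D \in L -> x \in B -> x \notin D /\ x |: D \in F) ->
  #|W| <= #|X| -> ~~ embeddable H F -> #|L| <= #|W| * #|shadow L|.
Proof.
move=> [uT treeT] redT /existsP[g /andP[/injectiveP injg /forall_inP gT]].
move=> /forall_inP crossS leSB uL LF leWX; rewrite leqNgt; apply: contra => ltL.
pose S' := g @: S.
have [U1 [_ cU1]] := leaf_set redT (m := fun E => (E :&: S' == set0) : nat)
  (fun _ _ => leq_b1 _).
pose U := S' :|: U1.
have [|f [injf fL]] := hypertree_embedding treeT _ uL ltL (U := U).
  move=> E ET; have := cU1 E ET; have := uniform_card uT ET => cE.
  have [E0|/set0Pn[w wE]] := eqVneq (E :&: S') set0 => c1.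
    apply: leq_trans (_ : #|E :\: U1| <= _); last by have := cardsID U1 E; lia.
    by apply/subset_leq_card/setDS/subsetUr.
  apply: leq_trans (_ : #|E :\: S'| <= _); first exact/subset_leq_card/setDS/subsetUl.
  have : 0 < #|E :&: S'| by apply/card_gt0P; exists w.
  by have := cardsID S' E; lia.
set C := _ :\: U in injf.
have [|||f1 [f1f injf1 f1B]] := @extend_injection W X f C S' B injf.
- by rewrite disjoints_subset; apply/subsetP => w wS; rewrite !inE wS.
- by rewrite (leq_trans (leq_imset_card _ _)).
- rewrite disjoints_subset; apply/subsetP => x xB; rewrite inE; apply/imsetP => -[w].
  move=> /setDP[/bigcupP[E ET wE] wU] xw; have [D DL fD] := fL E ET.
  have [/negP xD _] := LF D x DL xB; apply: xD; rewrite xw.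
  by apply: (subsetP fD); apply: imset_f; rewrite inE wU.
(* An edge coming from [H] meets [S'], so no vertex of [U1] was taken from it. *)
have gU E w : E \in H -> w \in g @: E -> w \notin S' -> w \in g @: E :\: U.
  move=> EH wE wS; rewrite !inE wE (negPf wS) andbT /=; apply/negP => wU1.
  have := cU1 _ (gT E EH); have /eqP/cards1P[s sS] := eqP (crossS E EH).
  rewrite (_ : (_ == set0) = false).
    by move/eqP; rewrite cards_eq0 => /eqP/setP/(_ w); rewrite !inE wE wU1.
  apply/negP => /eqP/setP/(_ (g s)); have : s \in S :&: E by rewrite sS inE.
  by rewrite !inE => /andP[sS' sE]; rewrite !imset_f.
have gC E w : E \in H -> w \in g @: E -> w \in C :|: S'.
  move=> EH wE; rewrite inE; have [|wS] := boolP (w \in S'); rewrite ?orbT ?orbF //.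
  have := gU E w EH wE wS; rewrite !inE => /andP[-> _].
  by apply/bigcupP; exists (g @: E); rewrite ?gT.
(* Only the edges of [T] that come from [H] are certain to land in [F], so the image of [H] replaces
   the tree here. *)
apply: (@embeddable_trans _ _ _ H [seq g @: (E : {set V}) | E in H] F f1) => //.
- apply/existsP; exists g; apply/andP; split; first exact/injectiveP.
  by apply/forall_inP => E EH; apply: image_f.
- move=> w w' /bigcupP[_ /imageP[E EH ->] wE] /bigcupP[_ /imageP[E' EH' ->] wE'].
  by apply: injf1; [apply: gC wE|apply: gC wE'].
move=> _ /imageP[E EH ->]; have [D DL fD] := fL _ (gT E EH).
have /cards1P[s sS] := crossS E EH.
have : s \in S :&: E by rewrite sS inE.
rewrite inE => /andP[sinS sE].
have xB : f1 (g s) \in B by apply/f1B/imset_f.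
have [xD xDF] := LF D _ DL xB.
suff -> : f1 @: (g @: E) = f1 (g s) |: D by [].
apply/eqP; rewrite eqEcard cardsU1 xD (uniform_card uL DL) card_in_imset; last first.
  by move=> w w' wE wE'; apply: injf1; [apply: gC wE|apply: gC wE'].
rewrite (uniform_card uT (gT E EH)) leqnn andbT.
apply/subsetP => _ /imsetP[w wE ->]; rewrite !inE.
have [/imsetP[v vS wv]|wS] := boolP (w \in S').
  have : v \in S :&: E.
    by rewrite inE vS; move: wE; rewrite wv => /imsetP[v' v'E /injg ->].
  by rewrite sS inE wv => /eqP->; rewrite eqxx.
have wC := gU E w EH wE wS; apply/orP; right; rewrite f1f.
  by apply: (subsetP fD); apply: imset_f.
move: wC; rewrite !inE => /andP[-> _]; apply/bigcupP; exists (g @: E); rewrite ?gT //.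
Qed.

(** * Minimum crosscuts *)

Lemma crosscut_number_leq (V : finType) (H : {set {set V}}) (S : {set V}) :
  crosscut H S -> crosscut_number H <= #|S|.
Proof.
move=> cS; rewrite /crosscut_number; have := mem_index_enum S.
elim: (index_enum _) => // A s IHs; rewrite inE big_cons => /predU1P[<-|/IHs{}IHs].
  by rewrite cS geq_minl.
by case: ifP => _ //; rewrite (leq_trans (geq_minr _ _)).
Qed.

Lemma crosscut_number_attained (V : finType) (H : {set {set V}}) (S0 : {set V}) :
  crosscut H S0 -> exists2 S, crosscut H S & #|S| = crosscut_number H.
Proof.
move=> cS0; case: (@arg_minnP _ S0 (crosscut H) (fun S => #|S|) cS0) => S cS minS.
exists S => //; apply/eqP; rewrite eqn_leq crosscut_number_leq // andbT.
rewrite /crosscut_number; elim/big_rec: _ => [|A m cA leSm]; first exact: max_card.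
by rewrite leq_min minS.
Qed.

(** One leaf of each edge of [T] gives a crosscut of [T], which is pulled back to [H]. *)
Lemma reducible_crosscut (V W : finType) (H : {set {set V}}) (T : seq {set W}) :
  reducible 1 T -> embeddable H [in T] -> exists S, crosscut H S.
Proof.
move=> redT /existsP[g /andP[/injectiveP injg /forall_inP gT]].
have [U [_ cU]] := leaf_set redT (m := fun=> 1) (fun _ _ => isT).
exists (g @^-1: U); apply/forall_inP => E EH; rewrite -(cU _ (gT E EH)).
rewrite -(card_imset (g @^-1: U :&: E) injg); apply/eqP; apply: eq_card => w.
rewrite inE; apply/imsetP/andP => [[v] /setIP[vU vE] ->|[/imsetP[v vE ->] vU]].
  by rewrite inE in vU; rewrite imset_f.
by exists v; rewrite // !inE vU.
Qed.

Lemma crosscut_card_gt0 (V : finType) (H : {set {set V}}) (S : {set V}) :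
  0 < #|H| -> crosscut H S -> 0 < #|S|.
Proof.
move=> /card_gt0P[E EH] /forall_inP/(_ E EH)/eqP cSE.
by apply: leq_trans (subset_leq_card (subsetIl S E)); rewrite cSE.
Qed.

(** * Upper bounds *)

Lemma turan_upper_single (V W : finType) (k n : nat) (H : {set {set V}})
    (T : seq {set W}) :
  rtree k.+3 T -> reducible 2 T -> embeddable H [in T] ->
  crosscut_number H = 1 -> #|W| <= n ->
  turan_number k.+3 n H <= (2 + k.+2) * #|W| ^ 2 * n ^ k.+1.
Proof.
move=> trT redT embH s1; rewrite -[n in _ <= n]card_ord => leWn.
have red1T : reducible 1 T by apply: sub_all redT => E; apply: ltnW.
have [S0 /crosscut_number_attained[S cS cardS]] := reducible_crosscut red1T embH.
apply/bigmax_leqP => F /andP[uF nembF].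
rewrite (leq_trans (card_leq_center_links #|W| uF)) //.
have G := card_two_poor trT redT embH uF leWn nembF.
have P := card_rich_sets trT redT embH uF leWn nembF.
have Sh := sum_shadow_center_links #|W| uF.
(* A minimum crosscut is a single vertex, so it can be sent to [x] alone. *)
have link_shadow x : #|center_link F #|W| x| <= #|W| * #|shadow (center_link F #|W| x)|.
  apply: (@card_common_links _ _ _ k H T S [set x] _ F) => //.
  - by rewrite cardS s1 cards1.
  - exact: center_link_uniform.
  - by move=> D y DL; rewrite inE => /eqP->; apply: (center_linkP DL).
have := leq_sum _ (fun x (_ : true) => link_shadow x).
move=> /(_ (index_enum _)); rewrite -big_distrr /= => le_links.
rewrite card_ord in G P *.
have := leq_mul (leqnn #|W|) (leq_trans Sh (leq_mul (leqnn k.+2) P)).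
move=> /(leq_trans le_links) {}le_links.
apply: (leq_trans (leq_add G le_links)).
by rewrite mulnDl mulnDl leq_add2l (mulnCA _ k.+2) -mulnn -!mulnA.
Qed.

Lemma card_subsets_leq (X : finType) (A : {set X}) (s : nat) :
  #|[set B : {set X} | (B \subset A) && (#|B| == s)]| <= #|A| ^ s.
Proof. by rewrite cards_draws leq_bin_exp. Qed.

(** The error terms account in turn for the edges in [two_poor], the centers outside [A], and the
    sets that lie in at least [s] of the links from [A]. The threshold [t] stays free, to be
    optimized later. *)
Lemma turan_upper (V W : finType) (k n t : nat) (H : {set {set V}})
    (T : seq {set W}) (s := crosscut_number H) :
  rtree k.+3 T -> reducible 2 T -> embeddable H [in T] ->
  0 < #|H| -> #|W| <= n -> 0 < t ->
  turan_number k.+3 n H <= s.-1 * 'C(n, k.+2)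
    + (2 * #|W| ^ 2 + t * (k.+2 * #|W|)
       + #|W| * ((k.+2 * #|W| * n ^ k.+1) %/ t ^ k.+1) ^ s.+1) * n ^ k.+1.
Proof.
move=> trT redT embH H0; rewrite -[n in _ <= n]card_ord => leWn t0.
have red1T : reducible 1 T by apply: sub_all redT => E; apply: ltnW.
have [S0 /crosscut_number_attained[S cS cardS]] := reducible_crosscut red1T embH.
have s0 : 0 < s by rewrite /s -cardS (crosscut_card_gt0 H0 cS).
apply/bigmax_leqP => F /andP[uF nembF].
rewrite (leq_trans (card_leq_center_links #|W| uF)) //.
have G := card_two_poor trT redT embH uF leWn nembF.
have P := card_rich_sets trT redT embH uF leWn nembF.
have Sh := sum_shadow_center_links #|W| uF.
have {Sh P} := leq_trans Sh (leq_mul (leqnn k.+2) P).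
rewrite card_ord mulnA in G *; set N := #|W| in G *; set C2 := k.+2 * N => Sh.
pose cl x := center_link F N x.
have ucl x : is_uniform k.+2 (cl x) by apply: center_link_uniform.
(* [A] consists of the few vertices that are the center of many edges. *)
pose A := [set x | t ^ k.+1 <= #|shadow (cl x)|].
have leA : #|A| <= (C2 * n ^ k.+1) %/ t ^ k.+1.
  rewrite leq_divRL ?expn_gt0 ?t0 // (leq_trans _ Sh) // -sum_nat_const.
  rewrite [leqRHS](bigID (mem A)) /= (leq_trans _ (leq_addr _ _)) //.
  by apply: leq_sum => x; rewrite inE.
set a := _ %/ _ in leA *.
have outA : \sum_(x | x \notin A) #|cl x| <= t * C2 * n ^ k.+1.
  rewrite -mulnA (leq_trans _ (leq_mul (leqnn t) Sh)) // big_distrr /=.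
  rewrite [leqRHS](bigID (mem A)) /= (leq_trans _ (leq_addl _ _)) //.
  by apply: leq_sum => x; rewrite inE -ltnNge; apply: card_leq_shadow.
pose mult D := #|[set x in A | D \in cl x]|.
pose B := [set D : {set 'I_n} | (#|D| == k.+2) && (s <= mult D)].
pose LL (Y : {set 'I_n}) := [set D : {set 'I_n} | (#|D| == k.+2) && [forall x in Y, D \in cl x]].
have leLL (Y : {set 'I_n}) : Y \subset A -> #|Y| = s -> #|LL Y| <= N * n ^ k.+1.
  move=> YA cY; have uLL : is_uniform k.+2 (LL Y).
    by apply/forall_inP => D; rewrite inE => /andP[].
  have := uniform_leq_exp (shadow_uniform uLL); rewrite card_ord => lesh.
  apply: leq_trans (leq_mul (leqnn N) lesh).
  apply: (@card_common_links _ _ _ k H T S Y _ F) => //; first by rewrite cY cardS.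
  move=> D x; rewrite inE => /andP[_ /forall_inP DY] /DY; exact: center_linkP.
(* A set in [B] is common to the links of some [s] vertices of [A], which can be chosen in at most
   [a ^ s] ways. *)
have leB : #|B| <= a ^ s * (N * n ^ k.+1).
  pose YY := [set Y : {set 'I_n} | (Y \subset A) && (#|Y| == s)].
  apply: leq_trans (_ : #|\bigcup_(Y in YY) LL Y| <= _).
    apply/subset_leq_card/subsetP => D; rewrite inE => /andP[cD].
    rewrite -bin_gt0 -cards_draws => /card_gt0P[Y]; rewrite inE => /andP[YD cY].
    apply/bigcupP; exists Y; rewrite inE ?cY ?cD ?andbT.
      by apply: subset_trans YD _; apply/subsetP => x /setIdP[].
    by apply/forall_inP => x /(subsetP YD)/setIdP[].
  apply: (leq_trans (card_bigcup_leq _ _)).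
  apply: leq_trans (_ : \sum_(Y in YY) N * n ^ k.+1 <= _).
    by apply: leq_sum => Y; rewrite inE => /andP[YA /eqP cY]; apply: leLL.
  rewrite sum_nat_const leq_mul // (leq_trans (card_subsets_leq _ _)) //.
  by rewrite leq_exp2r.
(* Pairs are counted by their set [D]: it lies in at most [s.-1] of the links, unless it belongs to
   [B], and always in at most [a]. *)
have inA : \sum_(x in A) #|cl x| <= s.-1 * 'C(n, k.+2) + #|B| * a.
  rewrite (eq_bigr (fun x => \sum_D (D \in cl x : nat))) => [|x _]; last first.
    by rewrite -sum1_card big_mkcond; apply: eq_bigr => D _; case: ifP.
  rewrite exchange_big /=.
  apply: leq_trans (_ : \sum_(D : {set 'I_n}) ((#|D| == k.+2) * s.-1 + (D \in B) * a) <= _).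
    apply: leq_sum => D _.
    have -> : \sum_(x in A) (D \in cl x : nat) = mult D.
      rewrite /mult -sum1dep_card [RHS]big_mkcondr.
      by apply: eq_bigr => x _; case: (D \in cl x).
    have [cD|ncD] := eqVneq #|D| k.+2; last first.
      rewrite /mult (_ : [set x in A | D \in cl x] = set0) ?cards0 //.
      apply/setP => x; rewrite !inE; apply/negP => /andP[_ Dx].
      by rewrite (uniform_card (ucl x) Dx) eqxx in ncD.
    rewrite inE cD eqxx mul1n /=; have [sm|] := leqP s (mult D).
      rewrite mul1n (leq_trans _ (leq_addl _ _)) // (leq_trans _ leA) //.
      by apply/subset_leq_card/subsetP => x /setIdP[].
    by rewrite -[X in _ < X](prednK s0) ltnS => /leq_trans; apply; apply: leq_addr.
  rewrite big_split /= -!big_distrl /= mulnC leq_add ?leq_mul //.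
    rewrite -[X in 'C(X, _)]card_ord -card_draws -sum1dep_card [leqRHS]big_mkcond.
    by apply: leq_sum => D _; case: ifP.
  by rewrite -sum1_card [leqRHS]big_mkcond; apply: leq_sum => D _; case: ifP.
rewrite [X in _ + X](bigID (mem A)) /=.
rewrite (leq_trans (leq_add G (leq_add inA outA))) //.
have := leq_mul leB (leqnn a); rewrite mulnAC -expnSr => leBa.
rewrite mulnDl mulnDl (mulnC N) -[a ^ _ * N * _]mulnA; move: leBa; lia.
Qed.

(** * The lower bound *)

Lemma leq_bin_subn (n m k : nat) : 'C(n, k.+1) <= 'C(n - m, k.+1) + m * n ^ k.
Proof.
elim: m => [|m IHm]; first by rewrite subn0 leq_addr.
apply: (leq_trans IHm); rewrite mulSn addnA leq_add2r subnS.
have := leq_subr m n; case: (n - m) => [//|p] lep.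
rewrite binS leq_add2l (leq_trans (leq_bin_exp _ _)) //.
by case: k {IHm} => // k; rewrite leq_exp2r // ltnW.
Qed.

(** An embedding of [H] into [G] would pull [S] back to a crosscut with at most [m] vertices, which
    is too few. *)
Lemma turan_lower (V : finType) (k n m : nat) (H : {set {set V}}) :
  m < crosscut_number H ->
  m * 'C(n, k.+1) <= turan_number k.+2 n H + m ^ 2 * n ^ k.
Proof.
(* For [n <= m] the error term alone suffices, since ['C(n, k.+1) <= n ^ k.+1 <= m * n ^ k]. *)
move=> ltm; have [lenm|ltmn] := leqP n m.
  rewrite (leq_trans _ (leq_addl _ _)) // -mulnn -mulnA leq_mul //.
  by rewrite (leq_trans (leq_bin_exp _ _)) // expnS leq_mul.
have [S cS] : exists S : {set 'I_n}, #|S| = m.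
  have : 0 < #|[set S : {set 'I_n} | #|S| == m]| by rewrite card_draws card_ord bin_gt0 ltnW.
  by case/card_gt0P => S; rewrite inE => /eqP; exists S.
pose G := [set E : {set 'I_n} | (#|E| == k.+2) && (#|S :&: E| == 1)].
have leG : m * 'C(n - m, k.+1) <= #|G|.
  pose DD := [set D : {set 'I_n} | (D \subset ~: S) && (#|D| == k.+1)].
  have DDP D : D \in DD -> [disjoint S & D] /\ #|D| = k.+1.
    by rewrite inE -disjoints_subset disjoint_sym => /andP[-> /eqP].
  have -> : m * 'C(n - m, k.+1) = #|setX S DD|.
    by rewrite cardsX cards_draws cS; congr (_ * 'C(_, _)); have := cardsC S; rewrite card_ord; lia.
  have meet x D : x \in S -> D \in DD -> S :&: (x |: D) = [set x].
    move=> xS /DDP[dSD _]; rewrite setIUr (disjoint_setI0 dSD) setU0.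
    by apply/setIidPr; rewrite sub1set.
  (* By [meet], both [x] and [D] can be recovered from [x |: D]. *)
  rewrite -(card_in_imset (f := fun p : 'I_n * {set 'I_n} => p.1 |: p.2)).
    apply/subset_leq_card/subsetP => _ /imsetP[[x D] /setXP[/= xS DD'] ->].
    have [dSD cD] := DDP D DD'.
    by rewrite inE /= meet // cards1 cardsU1 cD (disjointFr dSD xS) add1n !eqxx.
  move=> [x D] [y E] /setXP[/= xS DD'] /setXP[/= yS EE'] eqU.
  have exy : x = y by apply: set1_inj; rewrite -(meet x D) // eqU meet.
  have [dSD _] := DDP D DD'; have [dSE _] := DDP E EE'.
  congr pair => //; rewrite -(@setU1K _ x D) ?(disjointFr dSD xS) // eqU exy.
  by rewrite setU1K ?(disjointFr dSE yS).
have GT : #|G| <= turan_number k.+2 n H.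
  apply: leq_bigmax_cond; apply/andP; split.
    by apply/forall_inP => E; rewrite inE => /andP[].
  apply/existsP => -[f /andP[/injectiveP injf /forall_inP fG]].
  have : crosscut H (f @^-1: S).
    apply/forall_inP => E /fG; rewrite inE => /andP[_ /eqP <-].
    rewrite -(card_imset _ injf); apply/eqP; apply: eq_card => y.
    rewrite inE; apply/imsetP/andP => [[v] /setIP[vS vE] ->|[yS /imsetP[v vE yv]]].
      by rewrite imset_f //; rewrite inE in vS.
    by exists v; rewrite // !inE vE -yv yS.
  move/crosscut_number_leq; rewrite leqNgt; case/negP.
  rewrite (leq_ltn_trans _ ltm) // -cS -(card_imset _ injf).
  by apply/subset_leq_card/subsetP => _ /imsetP[v vS ->]; rewrite inE in vS.
apply: leq_trans (leq_add GT (leqnn _)); rewrite (leq_trans _ (leq_add leG (leqnn _))) //.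
by rewrite -mulnn -mulnA -mulnDr leq_mul // leq_bin_subn.
Qed.

(* Asymptotics over the reals *)
From mathcomp Require Import all_order all_algebra ring.
From mathcomp Require Import all_classical all_reals all_analysis.
Import Order.TTheory GRing.Theory Num.Theory.
Import numFieldNormedType.Exports.
Local Open Scope classical_set_scope.
Local Open Scope ring_scope.

Lemma turan_upper_powR (R : realType) (V W : finType) (k : nat)
    (H : {set {set V}}) (T : seq {set W}) (s := crosscut_number H)
    (beta : R := ((k.+1)%:R * (s%:R + 1) + 1)^-1) :
  rtree k.+3 T -> reducible 2 T -> embeddable H [in T] -> (0 < #|H|)%N ->
  exists2 K : R, 0 <= K & forall n, (0 < n)%N -> (#|W| <= n)%N ->
    (turan_number k.+3 n H)%:R <= s.-1%:R * 'C(n, k.+2)%:R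
      + K * n%:R `^ (k.+3%:R - 1 - beta).
Proof.
move=> trT redT embH H0; pose N := #|W|; pose C2 := (k.+2 * N)%N.
exists (2 * N ^ 2 + 2 * C2 + N * C2 ^ s.+1)%N%:R; first exact: ler0n.
move=> n n0 leWn.
have n_gt0 : 0 < n%:R :> R by rewrite ltr0n.
have n_neq0 : n%:R != 0 :> R by rewrite gt_eqF.
have d_gt0 : 0 < k.+1%:R * (s%:R + 1) + 1 :> R.
  by rewrite ltr_wpDl ?ltr01 // mulr_ge0 ?addr_ge0 ?ler0n ?ler01.
have beta_gt0 : 0 < beta by rewrite invr_gt0.
have betaE : beta * (k.+1%:R * (s%:R + 1)) = 1 - beta.
  have : beta * (k.+1%:R * (s%:R + 1) + 1) = 1 by rewrite mulVf // gt_eqF.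
  by rewrite mulrDr mulr1 => e; rewrite -[X in X - _]e addrK.
have beta1 : 0 <= 1 - beta.
  by rewrite -betaE mulr_ge0 ?(ltW beta_gt0) // mulr_ge0 ?addr_ge0 ?ler0n ?ler01.
(* With [t] about [n `^ (1 - beta)], the number of heavy centers is
   [O(n `^ (beta * (r-2)))], and both error terms of [turan_upper] are
   [O(n `^ (r-2 + 1 - beta))]: this is where [beta] comes from. *)
pose u : R := n%:R `^ (1 - beta).
have u_ge1 : 1 <= u.
  by have := @ler_powR R n%:R; rewrite ler1n => /(_ n0 0 (1 - beta) beta1); rewrite powRr0.
have u_gt0 : 0 < u by apply: lt_le_trans u_ge1.
(* The successor makes [t] positive and at least [u]; it is still at most [2 * u], because
   [u >= 1]. *)
pose t := (Num.truncn u).+1.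
have ut : u <= t%:R by apply/ltW/truncnS_gt.
have tu : t%:R <= 2 * u.
  rewrite -(natr1 (Num.truncn u)) mulr_natl mulr2n lerD //.
  by case/andP: (truncn_itv (ltW u_gt0)).
have nE : n%:R = u * n%:R `^ beta.
  by rewrite -powRD ?subrK ?powRr1 ?ler0n // n_neq0 implybT.
set a := ((C2 * n ^ k.+1) %/ t ^ k.+1)%N.
have le_a : a%:R <= C2%:R * (n%:R `^ beta) ^+ k.+1.
  have : (a * t ^ k.+1 <= C2 * n ^ k.+1)%N by apply: leq_divM.
  rewrite -(ler_nat R) !natrM !natrX => le_at.
  rewrite -(ler_pM2r (exprn_gt0 k.+1 u_gt0)) -mulrA -exprMn (mulrC _ u) -nE.
  apply: le_trans le_at; rewrite ler_wpM2l ?ler0n // lerXn2r ?nnegrE ?ler0n //.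
  exact: ltW.
(* By [betaE], the power of [n] with exponent [beta * (k.+1 * s.+1)] is exactly [u]. *)
have le_as : (a ^ s.+1)%:R <= (C2 ^ s.+1)%:R * u.
  rewrite !natrX; apply: le_trans (_ : (C2%:R * (n%:R `^ beta) ^+ k.+1) ^+ s.+1 <= _).
    by rewrite lerXn2r ?nnegrE ?ler0n // mulr_ge0 ?ler0n ?exprn_ge0 ?powR_ge0.
  rewrite exprMn -exprM -[(_ `^ _) ^+ _]powR_mulrn ?powR_ge0 // -powRrM.
  by rewrite natrM -(natr1 s) betaE.
have -> : n%:R `^ (k.+3%:R - 1 - beta) = u * n%:R ^+ k.+1.
  rewrite -powR_mulrn ?ler0n // -powRD ?n_neq0 ?implybT //; congr (_ `^ _).
  by rewrite -(natr1 k.+2) -(natr1 k.+1); ring.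
have := turan_upper trT redT embH H0 leWn (ltn0Sn (Num.truncn u)).
rewrite -/t -/N -/C2 -/s -/a -(ler_nat R) => /le_trans; apply.
rewrite natrD natrM lerD2l natrM natrX mulrA ler_wpM2r ?exprn_ge0 ?ler0n //.
set A := (2 * N ^ 2)%N.
rewrite (natrD _ (A + t * C2)%N) (natrD _ A) (natrD _ (A + 2 * C2)%N) (natrD _ A).
rewrite !mulrDl !lerD //.
- by rewrite ler_peMr ?ler0n.
- by rewrite !natrM mulrAC ler_wpM2r ?ler0n.
- by rewrite !natrM -mulrA ler_wpM2l ?ler0n.
Qed.

Lemma eqO_bound (R : realType) (f g : nat -> R) (K : R) (n0 : nat) :
  0 <= K -> (forall n, 0 <= g n) -> (forall n, (n0 <= n)%N -> `|f n| <= K * g n) ->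
  f =O_\oo g.
Proof.
(* [K] may be 0, whereas the constant of the big-O must be positive. *)
move=> K0 g0 fg; apply/eqO_exP; exists (K + 1); first by rewrite ltr_wpDl.
near=> n; rewrite (ger0_norm (g0 n)) (le_trans (fg n _)) //.
  by near: n; exact: nbhs_infty_ge.
by rewrite ler_wpM2r // lerDl.
Unshelve. all: by end_near.
Qed.

Theorem theorem4p1 (R : realType) (r : nat) (hr : (4 <= r)%N)
    (V : finType) (H : {set {set V}}) (H_uniform : is_uniform r H)
    (H_nonempty : (0 < #|H|)%N)
    (H_embeds : exists (W : finType) (T : seq {set W}),
        [/\ rtree r T, reducible 2 T & embeddable H [in T]]) :
  let s := crosscut_number H in
  let beta : R := ((r - 2)%:R * (s%:R + 1) + 1)^-1 in
  (exists e1 e2 : nat -> R,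
     [/\ e1 =O_\oo (fun n => n%:R ^+ (r - 2) : R),
         e2 =O_\oo (fun n => n%:R `^ (r%:R - 1 - beta) : R) &
         forall n : nat,
           (s%:R - 1) * 'C(n, r - 1)%:R + e1 n <= (turan_number r n H)%:R
             <= (s%:R - 1) * 'C(n, r - 1)%:R + e2 n])
  /\ (s = 1%N ->
      (fun n => (turan_number r n H)%:R : R) =O_\oo (fun n => n%:R ^+ (r - 2) : R)).
Proof.
case: r hr {H_uniform} H_embeds => [|[|[|k]]] // _ [W [T [trT redT embH]]].
rewrite !subSS !subn0 => s beta.
have red1T : reducible 1 T by apply: sub_all redT => E; apply: ltnW.
have [S0 /crosscut_number_attained[S cS cardS]] := reducible_crosscut red1T embH.
have s_gt0 : (0 < s)%N by rewrite /s -cardS (crosscut_card_gt0 H_nonempty cS).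
have sE : s%:R - 1 = s.-1%:R :> R by rewrite -[s in LHS](prednK s_gt0) -natr1 addrK.
have exp_ge0 n : 0 <= n%:R ^+ k.+1 :> R by rewrite exprn_ge0 ?ler0n.
split=> [|s1]; last first.
  apply: (@eqO_bound _ _ _ ((2 + k.+2) * #|W| ^ 2)%N%:R #|W|) => // n leWn.
  by rewrite ger0_norm ?ler0n // -natrX -natrM ler_nat (turan_upper_single trT).
have [K K0 upper] := @turan_upper_powR R _ _ _ _ _ trT redT embH H_nonempty.
pose main n : R := (s%:R - 1) * 'C(n, k.+2)%:R.
pose ex n : R := (turan_number k.+3 n H)%:R.
(* Truncating the difference at 0 fixes the sign of each error term, so that a one-sided bound
   controls its absolute value. *)
exists (fun n => Num.min 0 (ex n - main n)), (fun n => Num.max 0 (ex n - main n)).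
split=> [||n].
- apply: (@eqO_bound _ _ _ (s.-1 ^ 2)%N%:R 0) => // n _.
  have lower : main n <= ex n + (s.-1 ^ 2)%:R * n%:R ^+ k.+1.
    rewrite /main sE -natrX -!natrM -natrD ler_nat.
    by apply: turan_lower; rewrite -/s prednK.
  have lower0 : 0 <= (s.-1 ^ 2)%:R * n%:R ^+ k.+1 :> R by rewrite mulr_ge0 ?ler0n.
  by rewrite ler0_norm ?ge_min ?lexx // lerNl le_min oppr_le0 lower0 lerBrDl lerBlDr.
- apply: (@eqO_bound _ _ _ K (maxn 1 #|W|)) => // n.
  rewrite geq_max => /andP[n0 leWn]; rewrite ger0_norm ?le_max ?lexx //.
  rewrite ge_max mulr_ge0 ?powR_ge0 // lerBlDl /main sE.
  exact: upper.
- by rewrite -lerBrDl ge_min lexx orbT -lerBlDl le_max lexx orbT.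
Qed.
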